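(* Every $(D,L)$-Bonnet-Myers sharp graph $G=(V,E)$ is Lichnerowicz sharp with Laplace eigenfunction $f=d(x,\cdot)-\frac L2$, where $x$ is a pole of $G$. That is, $\lambda_1=\inf_{u\sim v}\kappa(u,v)$, and for every pole $x$ the function $f=d(x,\cdot)-\frac{L}{2}$ satisfies $\Delta_G f+\lambda_1 f=0$.
   Context: All graphs are finite, simple, undirected, unweighted, connected, and have at least one edge. $d$ denotes the combinatorial distance and $\mathrm{diam}(G)=\max_{x,y}d(x,y)$; $x\sim y$ means that $x,y$ are adjacent. A vertex $x$ is a pole if there is a vertex $y$ with $d(x,y)=\mathrm{diam}(G)$. For a $D$-regular graph $G=(V,E)$ and $x\in V$, let $\mu_x$ be the probability measure on $V$ giving mass $\frac1{D+1}$ to $x$ and to each of its $D$ neighbours. The Wasserstein distance of probability measures $\mu,\nu$ on $V$ is $W_1(\mu,\nu)=\inf_\pi\sum_{u,v\in V}d(u,v)\pi(u,v)$, where $\pi:V\times V\to[0,1]$ runs over all couplings with marginals $\mu$ and $\nu$. The (modified) Ollivier Ricci curvature of two different vertices $x,y$ is $$\kappa(x,y)=\frac{D+1}{D}\left(1-\frac{W_1(\mu_x,\mu_y)}{d(x,y)}\right).$$ A $D$-regular graph $G$ of diameter $L$ is called $(D,L)$-Bonnet-Myers sharp if $\inf_{x\sim y}\kappa(x,y)=\frac2L$. The normalized Laplacian of a $D$-regular graph is $\Delta_Gf(x)=\frac1D\sum_{y\sim x}(f(y)-f(x))$ for $f:V\to\mathbb R$. Let $\lambda_1$ be the smallest positive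 number $\lambda$ for which $\Delta_Gf+\lambda f=0$ has a nonzero solution $f$. (In general $\inf_{x\sim y}\kappa(x,y)\le\lambda_1$.) A $D$-regular graph $G$ is called Lichnerowicz sharp if $\inf_{x\sim y}\kappa(x,y)=\lambda_1$. *)

(* Defs.v *)
From mathcomp Require Import all_boot all_order all_algebra.
From mathcomp Require Import boolp classical_sets reals.

Set Implicit Arguments.
Unset Strict Implicit.
Unset Printing Implicit Defensive.

Import Order.TTheory GRing.Theory Num.Theory.
Local Open Scope classical_set_scope.
Local Open Scope ring_scope.

(* A graph on the finite vertex set V is given by its adjacency relation. *)
Definition simple_graph (V : finType) (e : rel V) : Prop :=
  symmetric e /\ irreflexive e.

Definition connected_graph (V : finType) (e : rel V) : Prop :=
  forall x y : V, connect e x y.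

Definition has_edge (V : finType) (e : rel V) : Prop :=
  exists x y : V, e x y.

Definition regular_graph (V : finType) (e : rel V) (D : nat) : Prop :=
  forall x : V, #|e x| = D.

Definition walk_of_length (V : finType) (e : rel V) (x y : V) (n : nat) : bool :=
  [exists p : n.-tuple V, path e x p && (last x p == y)].

(* The least length of a walk from x to y. A shortest walk has length < #|V|,
   so the search range loses nothing when x and y are connected; otherwise the
   value is #|V|. *)
Definition dist (V : finType) (e : rel V) (x y : V) : nat :=
  find (walk_of_length e x y) (iota 0 #|V|).

Definition diam (V : finType) (e : rel V) : nat :=
  (\max_(x : V) \max_(y : V) dist e x y)%N.

Definition pole (V : finType) (e : rel V) (x : V) : Prop :=
  exists y : V, dist e x y = diam e.

Definition ball_measure (R : realType) (V : finType) (e : rel V) (D : nat)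
    (x : V) : V -> R :=
  fun v => if (v == x) || e x v then D.+1%:R^-1 else 0.

Definition coupling (R : realType) (V : finType) (mu nu : V -> R)
    (pi : V -> V -> R) : Prop :=
  [/\ forall u v : V, 0 <= pi u v <= 1,
      forall u : V, \sum_(v : V) pi u v = mu u
    & forall v : V, \sum_(u : V) pi u v = nu v].

Definition transport_cost (R : realType) (V : finType) (e : rel V)
    (pi : V -> V -> R) : R :=
  \sum_(u : V) \sum_(v : V) (dist e u v)%:R * pi u v.

Definition W1 (R : realType) (V : finType) (e : rel V) (mu nu : V -> R) : R :=
  inf [set transport_cost e pi | pi in coupling mu nu].

Definition kappa (R : realType) (V : finType) (e : rel V) (D : nat)
    (x y : V) : R :=
  D.+1%:R / D%:R *
  (1 - W1 e (ball_measure R e D x) (ball_measure R e D y) / (dist e x y)%:R).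

Definition inf_kappa (R : realType) (V : finType) (e : rel V) (D : nat) : R :=
  inf [set k : R | exists x y : V, e x y /\ k = kappa R e D x y].

Definition bonnet_myers_sharp (R : realType) (V : finType) (e : rel V)
    (D L : nat) : Prop :=
  [/\ regular_graph e D, diam e = L & inf_kappa R e D = 2 / L%:R].

Definition laplacian (R : realType) (V : finType) (e : rel V) (D : nat)
    (f : V -> R) : V -> R :=
  fun x => D%:R^-1 * \sum_(y : V | e x y) (f y - f x).

(* Sign convention: f is an eigenfunction for lambda when
   Delta f + lambda f = 0. *)
Definition laplace_eigenfunction (R : realType) (V : finType) (e : rel V)
    (D : nat) (lambda : R) (f : V -> R) : Prop :=
  (exists x : V, f x != 0) /\
  (forall x : V, laplacian e D f x + lambda * f x = 0).

Definition positive_eigenvalue (R : realType) (V : finType) (e : rel V)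
    (D : nat) (lambda : R) : Prop :=
  0 < lambda /\ exists f : V -> R, laplace_eigenfunction e D lambda f.

Definition is_lambda1 (R : realType) (V : finType) (e : rel V) (D : nat)
    (lambda : R) : Prop :=
  positive_eigenvalue e D lambda /\
  (forall mu : R, positive_eigenvalue e D mu -> lambda <= mu).

Definition lichnerowicz_sharp (R : realType) (V : finType) (e : rel V)
    (D : nat) : Prop :=
  is_lambda1 e D (inf_kappa R e D).

(* Main.v *)
Require Import Defs.
From mathcomp Require Import all_boot all_order all_algebra.
From mathcomp Require Import boolp classical_sets reals.
From mathcomp Require Import ring lra.

(** Write K for the infimum of the curvatures of the edges, d for the distance,
    and A f x = f x + D/(D+1) * Delta f x for the mean of f over the ball
    around x.  Weak Kantorovich duality and kappa >= K on edges show that A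
    contracts Lipschitz constants: if f grows by at most c along every edge,
    then A f grows by at most c * (1 - D/(D+1) * K) along every edge
    ([curvature_contraction]).  The whole proof rests on this estimate, used
    twice.

    Apply it to an eigenfunction f for lambda, at an edge where the increment
    of f is the largest, c say.  Since A f = (1 - lambda * D/(D+1)) * f, the
    increment of A f there is c * (1 - lambda * D/(D+1)), whence K <= lambda
    ([lichnerowicz_inequality]).

    Apply it next to f = d(x,.), with c = 1.  Summing along a geodesic from x
    to z and using Delta f x <= 1 gives Delta f z <= 1 - K * d(x,z)
    ([laplacian_dist_le]).  When K = 2/L, this says that
    g_x = d(x,.) - L/2 satisfies Delta g_x + K * g_x <= 0, for every vertex x.
    If d(x,y) = L, the triangle inequality makes h = g_x + g_y nonnegative,
    and Delta h + K * h <= 0.  The sum of Delta h over all vertices vanishes,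
    so the sum of h is at most 0, and h = 0 ([supersolution_eq0]).  Thus
    g_y = - g_x, the inequality for g_y is the reverse of the one for g_x, and
    g_x is an eigenfunction for K ([pole_eigenfunction]).  A pole exists, so K
    is an eigenvalue, and by the first application it is the least positive
    one. *)

Import Order.TTheory GRing.Theory Num.Theory.
Local Open Scope ring_scope.

(** * Combinatorial distance *)

Lemma dist_le_walk {V : finType} {e : rel V} (x y : V) (n : nat) :
  walk_of_length e x y n -> (dist e x y <= n)%N.
Proof.
move=> walk; case: (ltnP n #|V|) => [lt_nV|le_Vn]; last first.
  by apply: leq_trans le_Vn; rewrite -[leqRHS](size_iota 0) find_size.
rewrite leqNgt; apply/negP => /(before_find 0%N).
by rewrite nth_iota // add0n walk.
Qed.

Lemma walk_of_dist {V : finType} {e : rel V} (econn : connected_graph e)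
    (x y : V) : walk_of_length e x y (dist e x y).
Proof.
(* Removing the loops of a walk leaves at most #|V| vertices, so the search
   that defines the distance succeeds. *)
have has_walk : has (walk_of_length e x y) (iota 0 #|V|).
  have /connectP[p0 path0 last0] := econn x y.
  case: (shortenP path0) last0 => p epath uniq_p _ ylast.
  apply/hasP; exists (size p).
    by rewrite mem_iota add0n -[(size p).+1]/(size (x :: p)) -(card_uniqP uniq_p)
      max_card.
  by apply/existsP; exists (in_tuple p); rewrite epath -ylast eqxx.
have lt_dV : (dist e x y < #|V|)%N.
  by rewrite -[X in (_ < X)%N](size_iota 0) -has_find.
by have := nth_find 0%N has_walk; rewrite nth_iota.
Qed.

Lemma dist_refl {V : finType} {e : rel V} (x : V) : dist e x x = 0%N.
Proof.
apply/eqP; rewrite -leqn0; apply: dist_le_walk.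
by apply/existsP; exists [tuple]; rewrite /= eqxx.
Qed.

Lemma dist_edge_le {V : finType} {e : rel V} (econn : connected_graph e)
    (x u v : V) : e u v -> (dist e x v <= (dist e x u).+1)%N.
Proof.
move=> euv; apply: dist_le_walk.
have /existsP[p /andP[epath /eqP plast]] := walk_of_dist econn x u.
apply/existsP; exists [tuple of rcons p v].
by rewrite /= rcons_path last_rcons epath plast euv eqxx.
Qed.

Lemma dist_edge {V : finType} {e : rel V} (esimple : simple_graph e)
    (econn : connected_graph e) (u v : V) : e u v -> dist e u v = 1%N.
Proof.
move=> euv; apply/eqP; rewrite eqn_leq.
have := dist_edge_le econn u u v euv; rewrite dist_refl => -> /=.
rewrite lt0n; apply/negP => /eqP d0.
have := walk_of_dist econn u v; rewrite d0.
move=> /existsP[p]; rewrite tuple0 /= => /eqP uv.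
by move: euv; rewrite uv (esimple.2 v).
Qed.

Lemma dist_le_diam {V : finType} {e : rel V} (x y : V) :
  (dist e x y <= diam e)%N.
Proof.
rewrite /diam; apply: leq_trans (leq_bigmax x).
exact: (leq_bigmax y).
Qed.

Lemma exists_pole {V : finType} {e : rel V} (x0 : V) : exists x, pole e x.
Proof.
have V_gt0 : (0 < #|V|)%N by apply/card_gt0P; exists x0.
have [x hx] := @bigop.eq_bigmax V (fun x => \max_(y : V) dist e x y) V_gt0.
have [y hy] := @bigop.eq_bigmax V (fun y => dist e x y) V_gt0.
by exists x; exists y; rewrite /diam hx hy.
Qed.

(** Telescoping along a geodesic.  The bound is one-sided and [c] is any real
    because [F] will be a Lipschitz function, the opposite of a distance, and
    a function of averages whose increments are bounded by a constant of
    unknown sign. *)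
Lemma edge_lipschitz_dist {R : realType} {V : finType} {e : rel V}
    (econn : connected_graph e) (F : V -> R) (c : R) :
  (forall u v, e u v -> F v - F u <= c) ->
  forall x z, F z - F x <= c * (dist e x z)%:R.
Proof.
move=> Fc x z.
have along_path q u : path e u q -> F (last u q) - F u <= c * (size q)%:R.
  elim: q u => [|w q IHq] u /=; first by rewrite subrr mulr0.
  move=> /andP[euw /IHq le_q]; have := Fc _ _ euw.
  rewrite -natr1; lra.
have /existsP[p /andP[epath /eqP plast]] := walk_of_dist econn x z.
by have := along_path p x epath; rewrite plast size_tuple.
Qed.

(** * Laplacian and ball measures *)

Lemma laplacian_le {R : realType} {V : finType} {e : rel V} {D : nat}
    (Dreg : regular_graph e D) (D_gt0 : (0 < D)%N) (f : V -> R) (c : R) (x : V) :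
  (forall y, e x y -> f y - f x <= c) -> laplacian e D f x <= c.
Proof.
move=> fc; rewrite /laplacian ler_pdivrMl ?ltr0n //.
have -> : D%:R * c = \sum_(y | e x y) c.
  by rewrite sumr_const mulr_natl; congr (_ *+ _); exact/esym/Dreg.
exact: ler_sum.
Qed.

(** Each edge contributes its increment once in each direction, with opposite signs. *)
Lemma sum_laplacian {R : realType} {V : finType} {e : rel V} {D : nat}
    (esym : symmetric e) (f : V -> R) : \sum_x laplacian e D f x = 0.
Proof.
rewrite /laplacian -mulr_sumr.
suff -> : \sum_x \sum_(y | e x y) (f y - f x) = 0 by rewrite mulr0.
under eq_bigr do rewrite sumrB.
rewrite sumrB; apply/eqP; rewrite subr_eq0; apply/eqP.
rewrite (exchange_big_dep predT) //=.
by apply: eq_bigr => y _; apply: eq_bigl => x; rewrite esym.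
Qed.

(** Integrating against the ball measures amounts to one step of a lazy random
    walk; this is what ties transport between balls to the Laplacian. *)
Lemma ball_measure_mean {R : realType} {V : finType} {e : rel V} {D : nat}
    (eirr : irreflexive e) (Dreg : regular_graph e D) (D_gt0 : (0 < D)%N)
    (f : V -> R) (x : V) :
  \sum_v f v * ball_measure R e D x v =
  f x + D%:R / D.+1%:R * laplacian e D f x.
Proof.
have -> : \sum_v f v * ball_measure R e D x v =
          (f x + \sum_(y | e x y) f y) / D.+1%:R.
  rewrite mulrDl mulr_suml (bigD1 x) //= {1}/ball_measure eqxx; congr (_ + _).
  rewrite big_mkcond [RHS]big_mkcond; apply: eq_bigr => v _.
  rewrite /ball_measure; case: eqVneq => [->|_] /=; first by rewrite eirr.
  by case: (e x v); rewrite // mulr0.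
rewrite /laplacian sumrB sumr_const (_ : #|_| = D); last exact: (Dreg x).
rewrite -[f x *+ D]mulr_natl.
have D0 : D%:R != 0 :> R by rewrite pnatr_eq0 -lt0n.
have S0 : D.+1%:R != 0 :> R by rewrite pnatr_eq0.
rewrite -natr1 in S0 *; field; exact/andP.
Qed.

Lemma ball_measure_sum {R : realType} {V : finType} {e : rel V} {D : nat}
    (eirr : irreflexive e) (Dreg : regular_graph e D) (D_gt0 : (0 < D)%N)
    (x : V) : \sum_v ball_measure R e D x v = 1.
Proof.
have lap1 : laplacian e D (fun=> 1 : R) x = 0.
  by rewrite /laplacian big1 ?mulr0 // => y _; rewrite subrr.
have := ball_measure_mean eirr Dreg D_gt0 (fun=> 1 : R) x.
rewrite lap1 mulr0 addr0 => <-.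
by apply: eq_bigr => v _; rewrite mul1r.
Qed.

Lemma ball_measure_bounds {R : realType} {V : finType} {e : rel V} {D : nat}
    (x v : V) : 0 <= ball_measure R e D x v <= 1.
Proof.
rewrite /ball_measure; case: ifP => _; last by rewrite lexx ler01.
by rewrite invr_ge0 ler0n invf_le1 ?ltr0n // ler1n.
Qed.

(** * Transport and curvature *)

(** The easy half of Kantorovich duality: integrate the Lipschitz bound against
    the coupling. *)
Lemma coupling_duality {R : realType} {V : finType} {e : rel V}
    {mu nu : V -> R} {P : V -> V -> R} (P_cpl : coupling mu nu P)
    (f : V -> R) (c : R) :
  (forall u v, f v - f u <= c * (dist e u v)%:R) ->
  \sum_v f v * nu v - \sum_v f v * mu v <= c * transport_cost e P.
Proof.
case: P_cpl => P01 P_mu P_nu f_lip.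
have -> : \sum_v f v * nu v = \sum_u \sum_v f v * P u v.
  rewrite exchange_big; apply: eq_bigr => v _.
  by rewrite -mulr_sumr P_nu.
have -> : \sum_u f u * mu u = \sum_u \sum_v f u * P u v.
  by apply: eq_bigr => u _; rewrite -mulr_sumr P_mu.
rewrite -sumrB mulr_sumr; apply: ler_sum => u _.
rewrite -sumrB mulr_sumr; apply: ler_sum => v _.
rewrite -mulrBl mulrA ler_wpM2r //.
by have /andP[] := P01 u v.
Qed.

Lemma W1_duality {R : realType} {V : finType} {e : rel V} {D : nat}
    (eirr : irreflexive e) (Dreg : regular_graph e D) (D_gt0 : (0 < D)%N)
    (f : V -> R) (c : R) (x y : V) :
  0 < c -> (forall u v, f v - f u <= c * (dist e u v)%:R) ->
  \sum_v f v * ball_measure R e D y v - \sum_v f v * ball_measure R e D x v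
    <= c * W1 e (ball_measure R e D x) (ball_measure R e D y).
Proof.
move=> c_gt0 f_lip; rewrite -ler_pdivrMl //; apply: lb_le_inf.
  (* The infimum is bounded below by its elements only if there is one: the
     product coupling. *)
  exists (transport_cost e
    (fun u v => ball_measure R e D x u * ball_measure R e D y v)).
  exists (fun u v => ball_measure R e D x u * ball_measure R e D y v) => //.
  split=> [u v|u|v].
  - have /andP[x0 x1] := ball_measure_bounds (R := R) (e := e) (D := D) x u.
    have /andP[y0 y1] := ball_measure_bounds (R := R) (e := e) (D := D) y v.
    by rewrite mulr_ge0 //= mulr_ile1.
  - by rewrite -mulr_sumr ball_measure_sum // mulr1.
  - by rewrite -mulr_suml ball_measure_sum // mul1r.
move=> _ [P P_cpl <-]; rewrite ler_pdivrMl //.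
exact: coupling_duality.
Qed.

(** An infimum of reals that is not a true infimum is 0 by convention, so a
    nonzero value already shows that the curvatures are bounded below. *)
Lemma inf_kappa_le {R : realType} {V : finType} {e : rel V} {D : nat}
    (x y : V) :
  inf_kappa R e D != 0 -> e x y -> inf_kappa R e D <= kappa R e D x y.
Proof.
move=> K_neq0 exy; apply: ge_inf; last by exists x, y.
apply: contrapT => no_lb; move: K_neq0.
by rewrite /inf_kappa inf_out ?eqxx // => -[].
Qed.

(** On an edge, [kappa >= K] means [W1 <= 1 - D/(D+1) * K], and by duality the
    difference of the means of [f] over the two balls is at most [c * W1]. *)
Lemma curvature_contraction {R : realType} {V : finType} {e : rel V} {D : nat}
    (esimple : simple_graph e) (econn : connected_graph e)
    (Dreg : regular_graph e D) (D_gt0 : (0 < D)%N)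
    (K_neq0 : inf_kappa R e D != 0) (f : V -> R) (c : R) :
  0 < c -> (forall u v, e u v -> f v - f u <= c) ->
  forall u v, e u v ->
  (f v + D%:R / D.+1%:R * laplacian e D f v)
    - (f u + D%:R / D.+1%:R * laplacian e D f u)
  <= c * (1 - D%:R / D.+1%:R * inf_kappa R e D).
Proof.
move=> c_gt0 fc u v euv.
have f_lip := edge_lipschitz_dist econn f c fc.
have := W1_duality esimple.2 Dreg D_gt0 f c u v c_gt0 f_lip.
rewrite !(ball_measure_mean esimple.2 Dreg D_gt0).
move=> /le_trans; apply; rewrite ler_pM2l //.
have := inf_kappa_le u v K_neq0 euv.
rewrite /kappa (dist_edge esimple econn _ _ euv) divr1.
rewrite -ler_pdivrMl ?divr_gt0 ?ltr0n // invf_div.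
by rewrite lerBrDr addrC -lerBrDr.
Qed.

(** * Eigenvalues and distance functions *)

(** The contraction estimate is tested on an edge where the eigenfunction has
    its largest increment [c], so that [c] cancels. *)
Lemma lichnerowicz_inequality {R : realType} {V : finType} {e : rel V}
    {D : nat} (esimple : simple_graph e) (econn : connected_graph e)
    (Dreg : regular_graph e D) (D_gt0 : (0 < D)%N) (eedge : has_edge e)
    (K_neq0 : inf_kappa R e D != 0) (lambda : R) :
  positive_eigenvalue e D lambda -> inf_kappa R e D <= lambda.
Proof.
move=> [lambda_gt0 [f [[w fw_neq0] feig]]].
have [a [b eab]] := eedge.
pose inc (p : V * V) := f p.2 - f p.1.
have [[u v] /= euv uv_max] :=
  @arg_maxP _ _ _ (a, b) (fun p => e p.1 p.2) inc eab.
set c := inc (u, v) in uv_max.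
have fc s t : e s t -> f t - f s <= c by exact: (uv_max (s, t)).
(* If no edge has a positive increment then, as edges are symmetric, the
   Laplacian of f vanishes, which excludes lambda > 0. *)
have [c_gt0|c_le0] := ltP 0 c; last first.
  have lap0 : laplacian e D f w = 0.
    rewrite /laplacian big1 ?mulr0 // => y ewy.
    have := fc _ _ ewy; have := fc y w; rewrite esimple.1 ewy => /(_ isT).
    lra.
  move: (feig w) => /eqP; rewrite lap0 add0r mulf_eq0 (negPf fw_neq0) orbF.
  by rewrite gt_eqF.
have := curvature_contraction esimple econn Dreg D_gt0 K_neq0 f c c_gt0 fc
  u v euv.
have lapE x : laplacian e D f x = - (lambda * f x).
  by apply/eqP; rewrite -addr_eq0; apply/eqP.
rewrite !lapE.
have -> : f v + D%:R / D.+1%:R * - (lambda * f v)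
          - (f u + D%:R / D.+1%:R * - (lambda * f u))
        = c * (1 - D%:R / D.+1%:R * lambda).
  by rewrite /c /inc /=; ring.
by rewrite ler_pM2l // lerD2l lerN2 ler_pM2l // divr_gt0 ?ltr0n.
Qed.

(** The contraction estimate is summed along a geodesic from [x] to [z]; doing
    so on edges replaces the triangle inequality for [W1]. *)
Lemma laplacian_dist_le {R : realType} {V : finType} {e : rel V} {D : nat}
    (esimple : simple_graph e) (econn : connected_graph e)
    (Dreg : regular_graph e D) (D_gt0 : (0 < D)%N)
    (K_neq0 : inf_kappa R e D != 0) (x z : V) :
  laplacian e D (fun y => (dist e x y)%:R) z
    <= 1 - inf_kappa R e D * (dist e x z)%:R.
Proof.
set f := fun y => (dist e x y)%:R : R.
have f_lip u v : e u v -> f v - f u <= 1.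
  by move=> euv; rewrite lerBlDr addrC natr1 ler_nat dist_edge_le.
have contr :=
  curvature_contraction esimple econn Dreg D_gt0 K_neq0 f 1 ltr01 f_lip.
have := edge_lipschitz_dist econn _ _ contr x z.
have lap_x : laplacian e D f x <= 1.
  by apply: (laplacian_le Dreg D_gt0) => y; exact: f_lip.
have f_x : f x = 0 by rewrite /f dist_refl.
rewrite /= -/(f z) f_x mul1r => le_z.
have q_gt0 : 0 < D%:R / D.+1%:R :> R by rewrite divr_gt0 ?ltr0n.
suff : D%:R / D.+1%:R * (laplacian e D f z - laplacian e D f x)
         <= D%:R / D.+1%:R * - (inf_kappa R e D * f z).
  rewrite ler_pM2l //; lra.
move: le_z; move: (D%:R / D.+1%:R : R) => q; lra.
Qed.

Lemma laplacianD {R : realType} {V : finType} {e : rel V} {D : nat}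
    (f g : V -> R) (x : V) :
  laplacian e D (fun y => f y + g y) x
    = laplacian e D f x + laplacian e D g x.
Proof.
rewrite /laplacian -mulrDr; congr (_ * _); rewrite -big_split /=.
by apply: eq_bigr => y _; ring.
Qed.

Lemma laplacian_subC {R : realType} {V : finType} {e : rel V} {D : nat}
    (f : V -> R) (c : R) (x : V) :
  laplacian e D (fun y => f y - c) x = laplacian e D f x.
Proof. by rewrite /laplacian; congr (_ * _); apply: eq_bigr => y _; ring. Qed.

(** Summing the inequality over all vertices removes the Laplacian and leaves
    [K * \sum_x h x <= 0]. *)
Lemma supersolution_eq0 {R : realType} {V : finType} {e : rel V} {D : nat}
    (esym : symmetric e) (h : V -> R) (K : R) :
  0 < K -> (forall x, 0 <= h x) ->
  (forall x, laplacian e D h x + K * h x <= 0) -> forall x, h x = 0.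
Proof.
move=> K_gt0 h_ge0 super.
have sum_le0 : \sum_x h x <= 0.
  rewrite -(pmulr_rle0 _ K_gt0) mulr_sumr.
  have : \sum_x (laplacian e D h x + K * h x) <= 0 by exact: sumr_le0.
  by rewrite big_split /= sum_laplacian // add0r.
have /eqP : \sum_x h x = 0 by apply: le_anti; rewrite sum_le0 sumr_ge0.
by rewrite psumr_eq0 // => /allP h0 x; apply/eqP/h0/mem_index_enum.
Qed.

(** Both [d(x,.) - L/2] and [d(y,.) - L/2], for antipodal [x] and [y], are
    supersolutions; their sum is a nonnegative supersolution, hence zero, and
    this forces equality in both. *)
Lemma pole_eigenfunction {R : realType} {V : finType} {e : rel V} {D L : nat}
    (esimple : simple_graph e) (econn : connected_graph e)
    (Dreg : regular_graph e D) (D_gt0 : (0 < D)%N) (L_gt0 : (0 < L)%N)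
    (diamL : diam e = L) (KL : inf_kappa R e D = 2 / L%:R) (x : V) :
  pole e x ->
  laplace_eigenfunction e D (inf_kappa R e D)
    (fun y => (dist e x y)%:R - L%:R / 2).
Proof.
move=> [y]; rewrite diamL => dxy.
have LR_gt0 : 0 < L%:R :> R by rewrite ltr0n.
have LR_neq0 : L%:R != 0 :> R by rewrite gt_eqF.
have K_gt0 : 0 < inf_kappa R e D by rewrite KL divr_gt0.
have K_neq0 : inf_kappa R e D != 0 by rewrite gt_eqF.
pose g (a z : V) : R := (dist e a z)%:R - L%:R / 2.
have super a z : laplacian e D (g a) z + inf_kappa R e D * g a z <= 0.
  rewrite laplacian_subC.
  have := laplacian_dist_le esimple econn Dreg D_gt0 K_neq0 a z.
  have -> : inf_kappa R e D * g a z =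
    inf_kappa R e D * (dist e a z)%:R - 1 by rewrite KL /g; field.
  lra.
pose h z := g x z + g y z.
have h_ge0 z : 0 <= h z.
  (* Following - d(x,.) from y to z gives d(x,y) <= d(x,z) + d(y,z) without
     reversing a geodesic. *)
  have neg_lip u v : e u v -> - (dist e x v)%:R - - (dist e x u)%:R <= 1 :> R.
    move=> euv; have : (dist e x u <= (dist e x v).+1)%N.
      by rewrite dist_edge_le // esimple.1.
    rewrite -(ler_nat R) -natr1; lra.
  have := edge_lipschitz_dist econn _ _ neg_lip y z.
  rewrite dxy /h /g; lra.
have h0 : forall z, h z = 0.
  apply: (supersolution_eq0 (D := D) esimple.1 h _ K_gt0 h_ge0) => z.
  rewrite laplacianD; have := super x z; have := super y z; rewrite /h; lra.
split=> [|z].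
  by exists x; rewrite dist_refl sub0r oppr_eq0 mulf_neq0 // invr_eq0 pnatr_eq0.
rewrite -/(g x) -/(g x z); apply: le_anti; rewrite super /=.
have lap_h : laplacian e D (g x) z + laplacian e D (g y) z = 0.
  rewrite -laplacianD /laplacian big1 ?mulr0 // => w _.
  by rewrite -/(h w) -/(h z) !h0 subrr.
have g_y : g y z = - g x z by apply/eqP; rewrite -addr_eq0 addrC -/(h z) h0.
have := super y z; rewrite g_y mulrN; lra.
Qed.

Theorem theorem1p5 (R : realType) (V : finType) (e : rel V) (D L : nat)
    (esimple : simple_graph e) (econn : connected_graph e) (eedge : has_edge e)
    (BM : bonnet_myers_sharp R e D L) :
  lichnerowicz_sharp R e D /\
  (forall lambda1 : R, is_lambda1 e D lambda1 ->
   forall x : V, pole e x ->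
   laplace_eigenfunction e D lambda1
     (fun y : V => (dist e x y)%:R - L%:R / 2)).
Proof.
have [Dreg diamL KL] := BM; have [a [b eab]] := eedge.
have D_gt0 : (0 < D)%N by rewrite -(Dreg a); apply/card_gt0P; exists b.
have L_gt0 : (0 < L)%N.
  by rewrite -diamL -(dist_edge esimple econn _ _ eab) dist_le_diam.
have K_gt0 : 0 < inf_kappa R e D by rewrite KL divr_gt0 ?ltr0n.
have K_neq0 : inf_kappa R e D != 0 by rewrite gt_eqF.
have eig := pole_eigenfunction esimple econn Dreg D_gt0 L_gt0 diamL KL.
have K_min := lichnerowicz_inequality esimple econn Dreg D_gt0 eedge K_neq0.
have K_eig : positive_eigenvalue e D (inf_kappa R e D).
  have [x x_pole] := exists_pole (e := e) a.
  by split=> //; eexists; exact: eig x_pole.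
split=> [|lambda1 [l_eig l_min] x x_pole]; first by split.
suff -> : lambda1 = inf_kappa R e D by exact: eig.
by apply: le_anti; rewrite l_min //= K_min.
Qed.
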